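(* The set $\{x\in(\frac34,\infty)\mid \liminf_{n\to\infty} C_{\mathbb R}^n(x)=\frac34\}$ is a comeager subset of $(\frac34,\infty)$.
   Context: For $x\in\mathbb R$ let $[x]$ be the unique integer with $x-[x]\in(-\frac12,\frac12]$. The map $C_{\mathbb R}$ is defined by $C_{\mathbb R}(x)=\frac{x}{2}$ if $[x]$ is even and $C_{\mathbb R}(x)=\frac{3x}{2}$ if $[x]$ is odd; it maps $(0,\infty)$ to itself, and $C_{\mathbb R}^n$ is its $n$-th iterate. *)

(* Defs.v *)
From HB Require Import structures.
From mathcomp Require Import all_boot all_order all_algebra.
From mathcomp Require Import all_classical all_reals all_analysis.
From mathcomp Require Import lra.
Set Implicit Arguments.
Unset Strict Implicit.
Unset Printing Implicit Defensive.
Import Order.TTheory GRing.Theory Num.Theory.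
Import numFieldNormedType.Exports.
Local Open Scope classical_set_scope.
Local Open Scope ring_scope.

(* Half-integers round down; see [nearest_int_unique]. *)
Definition nearest_int (R : realType) (x : R) : int := Num.ceil (x - 2^-1).

Lemma nearest_int_unique (R : realType) (x : R) (n : int) :
  (- 2^-1 < x - n%:~R <= 2^-1) <-> n = nearest_int x.
Proof.
have E m : (- 2^-1 < x - m%:~R <= 2^-1) = ((m - 1)%:~R < x - 2^-1 <= m%:~R).
  by rewrite intrB; apply/idP/idP => /andP[? ?]; apply/andP; split; lra.
split; first by rewrite E => /ceil_def.
by move=> ->; rewrite E; exact: ceil_itv.
Qed.

Definition collatz_real (R : realType) (x : R) : R :=
  if (2 %| nearest_int x)%Z then x / 2 else 3 * x / 2.

Definition nowhere_dense (T : topologicalType) (A : set T) : Prop :=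
  interior (closure A) = set0.

Definition meager (T : topologicalType) (A : set T) : Prop :=
  exists F : nat -> set T,
    (forall n, nowhere_dense (F n)) /\ A = \bigcup_n F n.

Definition comeager (T : topologicalType) (A : set T) : Prop := meager (~` A).

(* Main.v *)
(* C preserves (3/4, oo), and on it the liminf is 3/4 iff the infimum of the
   orbit is 3/4 (the infimum is never attained).  So it is enough that every
   interval contains a subinterval on which some iterate is close to 3/4.
   The branches x / 2 and 3 x / 2 differ by a factor 3, so for k >= 0 one has
   C (3^k x) = 3^k' C x with k' >= 0.  Comparing the orbit of
   z = 2^a / 3^b > 3/4 with that of 2^a, which reaches 1 after a steps, gives
   3^k C^a z = 1 with k >= 0; as C^a z > 3/4, this forces C^a z = 1.  By parity
   the orbit of z never meets a discontinuity before time a, so C^a x = x / z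
   for x slightly above z, and two more steps give (3/4) x / z.  Finally the
   numbers 2^a / 3^b are dense in (3/4, oo). *)
Require Import Defs.
From HB Require Import structures.
From mathcomp Require Import all_boot all_order all_algebra.
From mathcomp Require Import all_classical all_reals all_analysis.
From mathcomp Require Import ring lra.
Import Order.TTheory GRing.Theory Num.Theory.
Import numFieldNormedType.Exports.
Local Open Scope classical_set_scope.
Local Open Scope ring_scope.

(** * Orbits of [C], in particular those of the points [2 ^+ a / 3 ^+ b] *)

Section CollatzReal.
Context {R : realType}.
Implicit Types (x y z s t e : R) (a b k m n : nat).

Local Notation C := (@collatz_real R).

Lemma collatz_realE x (p : int) : - 2^-1 < x - p%:~R <= 2^-1 ->
  C x = if (2 %| p)%Z then x / 2 else 3 * x / 2.
Proof. by move=> /nearest_int_unique ->. Qed.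

Lemma collatz_real_odd x : 2^-1 < x <= 3 / 2 -> C x = 3 * x / 2.
Proof. by move=> xb; rewrite (@collatz_realE x 1)//; apply/andP; split; lra. Qed.

Lemma collatz_real_even x : 3 / 2 < x <= 5 / 2 -> C x = x / 2.
Proof. by move=> xb; rewrite (@collatz_realE x 2)//; apply/andP; split; lra. Qed.

Lemma collatz_real_or x : C x = x / 2 \/ C x = 3 * x / 2.
Proof. by rewrite /collatz_real; case: ifP; [left|right]. Qed.

(** Between 3/4 and 3/2 only the growing branch applies; beyond 3/2 even halving stays above 3/4. *)
Lemma collatz_real_gt x : 3 / 4 < x -> 3 / 4 < C x.
Proof.
move=> x34; have [x32|x32] := leP x (3 / 2).
  by rewrite collatz_real_odd; lra.
by case: (collatz_real_or x) => ->; lra.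
Qed.

Lemma iter_collatz_real_gt n x : 3 / 4 < x -> 3 / 4 < iter n C x.
Proof. by move=> x34; elim: n => //= n; exact: collatz_real_gt. Qed.

Lemma collatz_real_pow3 k x : exists k', C (3 ^+ k * x) = 3 ^+ k' * C x.
Proof.
case: k => [|k]; first by exists 0; rewrite !expr0 !mul1r.
case: (collatz_real_or x) => ->; case: (collatz_real_or (3 ^+ k.+1 * x)) => ->.
- by exists k.+1; rewrite mulrA.
- by exists k.+2; rewrite !exprS; field.
- by exists k; rewrite !exprS; field.
- by exists k.+1; rewrite !exprS; field.
Qed.

Lemma iter_collatz_real_pow3 n k x :
  exists k', iter n C (3 ^+ k * x) = 3 ^+ k' * iter n C x.
Proof.
elim: n => [|n [k' /= ->]]; first by exists k.
exact: collatz_real_pow3.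
Qed.

Lemma iter_collatz_real_pow2 n m : iter n C (2 ^+ (m + n)) = 2 ^+ m.
Proof.
elim: n m => [|n IH] m; first by rewrite addn0.
rewrite /= -addSnnS IH (@collatz_realE _ (2 ^+ m.+1)).
  by rewrite exprS dvdz_mulr// exprS mulrAC divff ?mul1r.
by rewrite rmorphXn/= subrr; apply/andP; split; lra.
Qed.

(** Doubling would equate the odd number [3 ^+ k * (p * 2 + 1)] with a positive power of 2. This
    keeps [2 ^+ n / 3 ^+ k] off the half-integers, where [C] jumps. *)
Lemma pow3_neq_pow2 k n (p : int) :
  3 ^+ k * (p%:~R + 2^-1) != 2 ^+ n :> R.
Proof.
apply/eqP => E.
have : 3 ^+ k * (p * 2 + 1) = 2 ^+ n.+1 :> int.
  apply: (@intr_inj R); rewrite intrM intrD intrM !rmorphXn/=.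
  by rewrite exprS -E; field.
move=> E2; have : (2 %| 3 ^+ k * (p * 2 + 1))%Z by rewrite E2 exprS dvdz_mulr.
rewrite Gauss_dvdzr; last by rewrite coprimezXr.
by rewrite rpredDl ?dvdz_mull.
Qed.

(** Half-integers round down, so only they lack a right neighbourhood on which [nearest_int] is
    constant; elsewhere [e] is the distance to the next half-integer. *)
Lemma collatz_real_near x : 0 < x ->
  x != (nearest_int x)%:~R + 2^-1 ->
  exists2 e, 0 < e & forall y, x <= y < x + e -> C y = C x / x * y.
Proof.
move=> x0 xN; have /nearest_int_unique xE := erefl (nearest_int x).
have xlt : x < (nearest_int x)%:~R + 2^-1 by rewrite lt_neqAle xN/=; lra.
exists ((nearest_int x)%:~R + 2^-1 - x); first lra.
move=> y xy; rewrite (@collatz_realE y (nearest_int x)); last first.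
  by apply/andP; split; lra.
by rewrite /collatz_real; case: ifP => _; field; rewrite gt_eqF.
Qed.

Section PowerRatio.
Variables (a b : nat) (z : R).
Hypotheses (zE : 3 ^+ b * z = 2 ^+ a) (z34 : 3 / 4 < z).

Let z0 : 0 < z. Proof. by apply: lt_trans z34; lra. Qed.

Lemma iter_collatz_real_ratio i : (i <= a)%N ->
  exists k, 3 ^+ k * iter i C z = 2 ^+ (a - i).
Proof.
move=> ia; have [k kE] := iter_collatz_real_pow3 i b z.
by exists k; rewrite -kE zE -[in 2 ^+ a](subnK ia) iter_collatz_real_pow2.
Qed.

Lemma iter_collatz_real_ratio1 : iter a C z = 1.
Proof.
have [[|k]] := iter_collatz_real_ratio _ (leqnn a); first by rewrite subnn !mul1r.
rewrite subnn expr0 exprS => E.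
have := iter_collatz_real_gt a z z34; set w := iter a C z in E *.
have : 1 <= 3 ^+ k :> R by rewrite exprn_ege1; lra.
by nra.
Qed.

Lemma iter_collatz_real_near i : (i <= a)%N ->
  exists2 e, 0 < e &
    forall x, z <= x < z + e -> iter i C x = iter i C z / z * x.
Proof.
elim: i => [_|i IH ia]; first by exists 1 => // x _ /=; field; rewrite gt_eqF.
have [e e0 He] := IH (ltnW ia).
have w0 : 0 < iter i C z by have := iter_collatz_real_gt i z z34; lra.
have [k kE] := iter_collatz_real_ratio _ (ltnW ia).
have [|d d0 Hd] := collatz_real_near _ w0.
  apply/eqP => wE; have := pow3_neq_pow2 k (a - i) (nearest_int (iter i C z)).
  by rewrite -wE kE eqxx.
set w := iter i C z in w0 Hd He *.
(* Up to time [i] the map is multiplication by [w / z], so the radius [d] at [w] pulls back to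
   [d * z / w] at [z]. *)
exists (Num.min e (d * z / w)); first by rewrite lt_min e0/= divr_gt0 ?mulr_gt0.
move=> x /andP[zx]; rewrite addrC -ltrBlDr lt_min => /andP[xe xd] /=.
rewrite He; last by apply/andP; split; lra.
rewrite Hd; first by rewrite -/w; field; rewrite !gt_eqF.
have wz : w / z * x = w + (x - z) * (w / z) by field; rewrite gt_eqF.
have wz0 : 0 < w / z by rewrite divr_gt0.
apply/andP; split; first by rewrite wz lerDl mulr_ge0 ?subr_ge0// ltW.
by rewrite wz ltrD2l -ltr_pdivlMr// invf_div mulrA.
Qed.

End PowerRatio.

End CollatzReal.

(** * Density of the ratios [2 ^+ a / 3 ^+ b] *)

Section Density.
Context {R : realType}.
Implicit Types (x y z s t e c d : R) (a b k m n : nat).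

(** Take the first term below [t]. It is not term 0, as [t <= c]; its predecessor is at least [t],
    so it is itself at least [d * t > s]. *)
Lemma geometric_hits c d s t : 0 < d < 1 -> 0 < s -> s < d * t -> t <= c ->
  exists n, s < c * d ^+ n < t.
Proof.
move=> /andP[d0 d1] s0 sdt tc; have t0 : 0 < t by nra.
have ex : exists n, c * d ^+ n < t.
  have d1' : `|d| < 1 by rewrite gtr0_norm.
  have [N _ HN] := cvgr_lt 0 (cvg_geometric c d1') t t0.
  by exists N; exact: (HN N (leqnn N)).
exists (ex_minn ex); case: ex_minnP => -[|n] nt nmin.
  by move: nt; rewrite mulr1 ltNge tc.
rewrite nt andbT (lt_le_trans sdt)// exprS mulrCA ler_pM2l// leNgt.
by apply/negP => /nmin; rewrite ltnn.
Qed.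

Let ratio a b : R := 2 ^+ a / 3 ^+ b.

Let ratio_gt0 a b : 0 < ratio a b.
Proof. by rewrite divr_gt0// exprn_gt0. Qed.

Let ratioM a b a' b' : ratio a b * ratio a' b' = ratio (a + a') (b + b').
Proof. by rewrite /ratio !exprD mulf_div. Qed.

Let ratioX a b n : ratio a b ^+ n = ratio (a * n) (b * n).
Proof. by rewrite /ratio expr_div_n !exprM. Qed.

Let ratio_eq1 a b : ratio a b = 1 -> a = 0.
Proof.
move=> /divr1_eq/eqP; rewrite -!natrX eqr_nat => /eqP; case: a => // a.
by move=> /(congr1 odd); rewrite !oddX orbT.
Qed.

(** Otherwise 1 is isolated among the ratios. A ratio near the infimum of those above 1, times one
    near the supremum of those below 1, is a ratio inside the gap, hence 1, which parity
    excludes. *)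
Lemma pow2_pow3_near1 e : 1 < e ->
  exists a b, 2 ^+ a / 3 ^+ b != 1 :> R /\ e^-1 < 2 ^+ a / 3 ^+ b < e.
Proof.
move=> e1; apply: contrapT => H.
have {}H a b : ratio a b != 1 -> e <= ratio a b \/ ratio a b <= e^-1.
  move=> r1; have [|re] := leP e (ratio a b); first by left.
  have [|er] := leP (ratio a b) e^-1; first by right.
  by exfalso; apply: H; exists a, b; rewrite -/(ratio a b) er re.
have e0 : 0 < e by lra.
have ei1 : e^-1 < 1 by rewrite invf_lt1.
pose U : set R := [set u | exists a b, u = ratio a b /\ 1 < u].
pose D : set R := [set u | exists a b, u = ratio a b /\ u < 1].
have Ue : lbound U e.
  move=> _ [a [b [-> r1]]]; have [|//|] := H a b; first by rewrite gt_eqF.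
  by move=> ?; lra.
have De : ubound D e^-1.
  move=> _ [a [b [-> r1]]]; have [|//|//] := H a b; first by rewrite lt_eqF.
  by move=> ?; lra.
have U0 : U 2 by exists 1, 0; rewrite /ratio expr0 divr1 expr1; split; lra.
have D0 : D 3^-1 by exists 0, 1; rewrite /ratio expr0 expr1 mul1r; split; lra.
have hU : has_inf U by split; [exists 2|exists e].
have hD : has_sup D by split; [exists 3^-1|exists e^-1].
have Le : e <= inf U by apply: lb_le_inf => //; exists 2.
have Me : sup D <= e^-1 by apply: ge_sup => //; exists 3^-1.
have M0 : 3^-1 <= sup D by apply: sup_upper_bound.
set L := inf U in Le *; set M := sup D in Me M0 *.
have M1 : 0 < M < 1 by apply/andP; split; lra.
have L1 : 1 < L by lra.
(* L <= u < L / M and M / L < d <= M give M < u d < L, hence u d = 1. *)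
have LM : 0 < L / M - L.
  by rewrite subr_gt0 ltr_pdivlMr; [nra|lra].
have ML : 0 < M - M / L.
  by rewrite subr_gt0 ltr_pdivrMr; [nra|lra].
have [_ [a [b [-> u1]]]] := inf_adherent LM hU.
rewrite addrC subrK ltr_pdivlMr => [uL|]; last by lra.
have [_ [a' [b' [-> d1]]]] := sup_adherent ML hD.
rewrite -/M subKr ltr_pdivrMr => [dM|]; last by lra.
have Lu : L <= ratio a b by apply: ge_inf; [case: hU|exists a, b].
have Md : ratio a' b' <= M by apply: sup_upper_bound => //; exists a', b'.
have := ratio_gt0 a b; have := ratio_gt0 a' b' => rd0 ru0.
have [lt1|gt1|] := ltgtP (ratio a b * ratio a' b') 1.
- have : ratio a b * ratio a' b' <= M.
    apply: sup_upper_bound => //.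
    by exists (a + a')%N, (b + b')%N; split; [exact: ratioM|].
  by nra.
- have : L <= ratio a b * ratio a' b'.
    apply: ge_inf; [by case: hU|].
    by exists (a + a')%N, (b + b')%N; split; [exact: ratioM|].
  by nra.
(* A product equal to 1 has no factor 2, so [a = 0] and the ratio chosen above 1 would be
   [1 / 3 ^+ b]. *)
- rewrite ratioM => /ratio_eq1/eqP; rewrite addn_eq0 => /andP[/eqP a0 _].
  move: u1; rewrite a0 /ratio expr0 mul1r invf_gt1 ?exprn_gt0//.
  by rewrite ltNge exprn_ege1//; lra.
Qed.

(** Powers of a ratio within a factor [t / s] of 1 advance in steps too short to jump over the
    interval. *)
Lemma pow2_pow3_dense s t : 3 / 4 <= s -> s < t ->
  exists a b, s < 2 ^+ a / 3 ^+ b < t.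
Proof.
move=> s34 st; have s0 : 0 < s by lra.
have t0 : 0 < t by lra.
have [|a [b [r1 /andP[rgt rlt]]]] := @pow2_pow3_near1 (t / s).
  by rewrite ltr_pdivlMr// mul1r.
rewrite invf_div -/(ratio a b) in rgt r1 rlt.
have r0 := ratio_gt0 a b.
move: rgt rlt; rewrite ltr_pdivrMr// ltr_pdivlMr// => rgt rlt.
have [lt1|gt1|/eqP] := ltgtP (ratio a b) 1; last by rewrite (negbTE r1).
(* Ratio below 1: descend from a power of 2 beyond [t]. *)
- have t2 : t <= 2 ^+ (Num.trunc t).+1.
    rewrite (le_trans (ltW (truncnS_gt t)))// -natrX ler_nat ltnW//.
    exact: ltn_expl.
  have [||n] := @geometric_hits _ (ratio a b) s t _ s0 _ t2 => //.
    exact/andP.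
  rewrite ratioX -[2 ^+ _](divr1) -(expr0 3) -/(ratio _ 0) ratioM => sn.
  by do 2!eexists; exact: sn.
(* Ratio above 1: descend through the reciprocals. The start 3/2 is the inverse of [ratio 1 1] and
   exceeds [s^-1 <= 4 / 3]. *)
- have [||||n] := @geometric_hits (3 / 2) (ratio a b)^-1 t^-1 s^-1.
  + by rewrite invr_gt0 r0 invf_lt1.
  + by rewrite invr_gt0.
  + by rewrite -invfM ltf_pV2 ?posrE// mulr_gt0.
  + by rewrite -div1r ler_pdivrMr//; lra.
  have -> : 3 / 2 * (ratio a b)^-1 ^+ n = (ratio 1 1 * ratio a b ^+ n)^-1.
    by rewrite exprVn invfM /ratio !expr1 invf_div.
  rewrite ratioX ratioM.
  rewrite !ltf_pV2 ?posrE// andbC => sn.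
  by do 2!eexists; exact: sn.
Qed.

End Density.

(** * Orbits approaching 3/4, the liminf, and nowhere density in a subspace *)

Section Target.
Context {R : realType}.
Implicit Types (x s t e : R) (u : R^nat) (n : nat).

Local Notation C := (@collatz_real R).

Lemma collatz_real_hits_near34 s t e : 3 / 4 <= s -> s < t -> 0 < e ->
  exists s' t', [/\ s <= s', s' < t', t' <= t &
    forall x, s' < x < t' -> exists n, iter n C x < 3 / 4 + e].
Proof.
move=> s34 st e0; have [a [b /andP[]]] := pow2_pow3_dense s t s34 st.
set z := 2 ^+ a / 3 ^+ b => sz zt.
have zE : 3 ^+ b * z = 2 ^+ a by rewrite mulrC divfK// expf_neq0.
have z34 : 3 / 4 < z by lra.
have z0 : 0 < z by lra.
have [d d0] := iter_collatz_real_near _ _ _ zE z34 _ (leqnn a).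
rewrite (iter_collatz_real_ratio1 _ _ _ zE z34) => Hd.
(* For [w] in (1, 3/2) the odd branch leads into (3/2, 9/4), where [C] halves; [w < 1 + e] then
   gives [3 * w / 4 < 3 / 4 + e]. *)
pose r := Num.min (3 / 2) (1 + e).
have r1 : 1 < r by rewrite lt_min; apply/andP; split; lra.
(* The interval lies to the right of [z]: a value just below 1 would take the odd branch twice. *)
exists z, (Num.min (Num.min (z + d) t) (z * r)); split.
- exact: ltW.
- by rewrite !lt_min ltrDl d0 zt ltr_pMr.
- by rewrite !ge_min lexx orbT.
move=> x /andP[zx]; rewrite !lt_min => /andP[/andP[xd _] xr].
have xzr : x / z < r by rewrite ltr_pdivrMr// mulrC.
have xz1 : 1 < x / z by rewrite ltr_pdivlMr// mul1r.
have itE : iter a C x = x / z.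
  by rewrite Hd ?zx ?(ltW zx)// div1r mulrC.
move: xzr; rewrite lt_min => /andP[xz32 xze].
exists a.+2; rewrite /= itE; move: (x / z) xz1 xz32 xze => w w1 w32 we.
rewrite (@collatz_real_odd _ w); last by apply/andP; split; lra.
by rewrite collatz_real_even; first lra; apply/andP; split; lra.
Qed.

(** Each finite initial segment stays away from [l], so values close to [l] must recur arbitrarily
    late. *)
Lemma limn_einf_eq_unattained u (l : R) : (forall n, l < u n) ->
  limn_einf (fun n => (u n)%:E) = l%:E <->
  forall k, exists n, u n < l + k.+1%:R^-1.
Proof.
move=> lu; rewrite limn_einf_lim.
have le_einfs n : (l%:E <= einfs (fun n => (u n)%:E) n)%E.
  by apply: le_ereal_inf_tmp => _ [m _ <-]; rewrite lee_fin ltW.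
split=> [lim_l k|H].
  apply: contrapT => Hk.
  have : ((l + k.+1%:R^-1)%:E <= limn (einfs (fun n => (u n)%:E)))%E.
    apply: lime_ge; first exact: is_cvg_einfs.
    apply: nearW => n; apply: le_ereal_inf_tmp => _ [m _ <-].
    by rewrite lee_fin leNgt; apply/negP => um; apply: Hk; exists m.
  by rewrite lim_l lee_fin gerDl leNgt invr_gt0 ltr0n.
have {}H e n : 0 < e -> exists2 m, (n <= m)%N & u m < l + e.
  elim: n e => [|n IH] e e0.
    have [m mE] := H (Num.trunc e^-1); exists m => //.
    apply: lt_trans mE _.
    by rewrite ltrD2l invf_plt ?posrE ?ltr0n// truncnS_gt.
  (* Asking also for a value below [u n] rules out [m = n]. *)
  have [|m nm] := IH (Num.min e (u n - l)); first by rewrite lt_min e0 subr_gt0 lu.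
  rewrite -ltrBlDl lt_min !ltrBlDl => /andP[ume]; rewrite subrKC => umn.
  exists m => //; rewrite ltn_neqAle nm andbT.
  by apply: contraTneq umn => ->; rewrite ltxx.
suff -> : einfs (fun n => (u n)%:E) = cst l%:E by rewrite lim_cst.
apply/funext => n; apply/eqP; rewrite eq_le le_einfs andbT.
apply/lee_addgt0Pr => e e0; have [m nm um] := H e n e0.
by apply: ge_ereal_inf; exists (u m)%:E; [exists m|rewrite -EFinD lee_fin ltW].
Qed.

(** Reduces nowhere density in the subspace to real intervals: to the right of an interior point of
    the closure, the midpoint of a subinterval free of [F] would lie in that closure. *)
Lemma nowhere_dense_subtype (A : set R) (F : set (set_type A)) :
  open A ->
  (forall s t, s < t -> `]s, t[ `<=` A -> exists s' t',
    [/\ s <= s', s' < t', t' <= t &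
      forall x : set_type A, s' < set_val x < t' -> ~ F x]) ->
  nowhere_dense F.
Proof.
move=> oA H; rewrite /nowhere_dense -subset0 => p.
rewrite /interior nbhsE => -[_ [[U oU <-] /= Up] UF].
have : nbhs (set_val p) (U `&` A).
  by apply: open_nbhs_nbhs; split; [exact: openI|split => //; exact: set_valP].
move=> /nbhs_ballP[e /= e0 He].
have [||s' [t' [ps' st' te sF]]] := H (set_val p) (set_val p + e).
- by rewrite ltrDl.
- move=> x /=; rewrite in_itv/= => /andP[px xe]; apply: (He x _).2.
  by rewrite /ball/= ltr_distlC; apply/andP; split; lra.
have s'q : s' < (s' + t') / 2 by lra.
have qt' : (s' + t') / 2 < t' by lra.
have [Uq Aq] : (U `&` A) ((s' + t') / 2).
  by apply: He; rewrite /ball/= ltr_distlC; apply/andP; split; lra.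
pose q : set_type A := SigSub (mem_set Aq).
have [|x [Fx]] := UF q Uq (set_val @^-1` `]s', t'[).
  apply: open_nbhs_nbhs; split; last by rewrite /= in_itv/= s'q.
  by exists `]s', t'[%classic => //; exact: interval_open.
by rewrite /= in_itv/= => /sF/(_ Fx).
Qed.

End Target.

Theorem theorem1p3 (R : realType) :
  comeager [set x : set_type [set y : R | 3 / 4 < y] |
    limn_einf (fun n : nat => (iter n (@collatz_real R) (set_val x))%:E)
      = (3 / 4)%:E].
Proof.
(* The liminf differs from 3/4 exactly when, for some [k], the whole orbit stays at least
   [k.+1%:R^-1] above 3/4. *)
exists (fun k => [set x | forall n,
  3 / 4 + k.+1%:R^-1 <= iter n (@collatz_real R) (set_val x)]); split.
  move=> k; apply: nowhere_dense_subtype; first exact: open_gt.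
  move=> s t st sA; have s34 : 3 / 4 <= s.
    rewrite leNgt; apply/negP => s34.
    (* If [s < 3 / 4], this point is in the interval but not above 3/4. *)
    have := sA (Num.min ((s + t) / 2) (3 / 4)).
    rewrite /= in_itv/= lt_min gt_min lt_min ltxx andbF => H.
    by suff : false by []; apply: H; apply/andP; split; [apply/andP; split|]; lra.
  have k0 : 0 < k.+1%:R^-1 :> R by rewrite invr_gt0.
  have [s' [t' [ss' st' tt' H]]] := collatz_real_hits_near34 _ _ _ s34 st k0.
  exists s', t'; split => // x /H[n nk] /(_ n).
  by rewrite leNgt nk.
have near34 (x : set_type [set y : R | 3 / 4 < y]) :=
  limn_einf_eq_unattained _ _ (fun n => iter_collatz_real_gt n _ (set_valP x)).
apply/seteqP; split=> x /=.
  rewrite near34 => /existsNP[k Hk]; exists k => //= n.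
  by rewrite leNgt; apply/negP => nk; apply: Hk; exists n.
move=> [k _ Hk] /near34/(_ k)[n].
by rewrite ltNge Hk.
Qed.
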